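(* For each $t\in\mathbb N=\{1,2,\dots\}$ let $F_t=(1-\alpha_t)I+\alpha_t T_t:\mathcal D\to\mathcal D$ be an $\alpha_t$-averaged operator, where $\alpha_t\in(0,1)$ and $T_t:\mathcal D\to\mathcal D$ is non-expansive. Let $\{x_t^\star\}_{t\in\mathbb N}\subset\mathcal D$ satisfy $x_t^\star=F_t(x_t^\star)$ for each $t$, and let $\{\sigma_t\}_{t\in\mathbb N}$ be finite non-negative scalars with $\|x_{t+1}^\star-x_t^\star\|\le\sigma_t$ for all $t$. For each $t$, let $\hat T_t:\mathcal D\to\mathcal D$ be a map, put $\hat F_t:=(1-\alpha_t)I+\alpha_t\hat T_t$, and assume: (1) there is a finite scalar $e_t$ with $\|T_t(x)-\hat T_t(x)\|\le e_t$ for all $x\in\mathcal D$; (2) there is a scalar $0\le L_t\le 1$ with $\|F_t(x)-F_t(x')\|\le L_t\|x-x'\|$ for all $x,x'\in\mathcal D$; (3) there is a finite scalar $M_t$ with $\|F_t(x)\|\le M_t$ and $\|\hat F_t(x)\|\le M_t$ for all $x\in\mathcal D$. Let $M:=\sup_t M_t$, $\sigma:=\sup_t\sigma_t$ and $e:=\sup_t e_t$ be finite. Suppose that $\sum_{t=1}^T e_t=o(T)$ as $T\to\infty$. Let $x_1\in\mathcal D$ and let $\{x_t\}$ be generated by $x_{t+1}=\hat F_t(x_t)=(1-\alpha_t)x_t+\alpha_t\hat T_t(x_t)$. Then $$\limsup_{T\to\infty}\frac1T\sum_{t=1}^T\|x_t-T_t(x_t)\|^2\le\check\alpha^{-1}\sigma(4M+\sigma),$$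 $$\limsup_{T\to\infty}\frac1T\sum_{t=1}^T\|x_t-F_t(x_t)\|^2\le\bar\alpha^{-1}\sigma(4M+\sigma),$$ where $\check\alpha:=\inf_t\{\alpha_t(1-\alpha_t)\}$ and $\bar\alpha:=\inf_t\{(1-\alpha_t)/\alpha_t\}$, each bound being asserted when the corresponding infimum is positive, so that its right-hand side is defined.
   Context: The ambient space is $\mathbb R^m$ with norm $\|\cdot\|$ induced by an inner product (e.g. the Euclidean norm), and $\mathcal D\subseteq\mathbb R^m$ is a nonempty closed convex set. $I$ is the identity operator. An operator $S:\mathcal D\to\mathcal D$ is non-expansive if $\|S(x)-S(y)\|\le\|x-y\|$ for all $x,y\in\mathcal D$. An operator $F:\mathcal D\to\mathcal D$ is $\alpha$-averaged, $\alpha\in(0,1)$, if $F=(1-\alpha)I+\alpha S$ for some non-expansive $S$. The notation $f(n)=o(g(n))$ means that for every $\varphi>0$ there exists $N$ with $|f(n)|\le\varphi|g(n)|$ for all $n\ge N$. Suprema and infima are over $t\in\mathbb N$. The symbol $T$ without subscript is the number of steps, while $T_t$ denotes an operator. *)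

(* Defs.v *)
From mathcomp Require Import all_boot all_order all_algebra.
From mathcomp Require Import all_classical all_reals all_analysis.
Set Implicit Arguments.
Unset Strict Implicit.
Unset Printing Implicit Defensive.
Import Order.TTheory GRing.Theory Num.Theory.
Import numFieldNormedType.Exports.
Local Open Scope classical_set_scope.
Local Open Scope ring_scope.

(* The canonical norm [`|x|] of ['rV[R]_m] is the sup norm, which no inner
   product induces when m > 1; the norm used here is [dot_norm dot].  Its
   topology is the canonical one, since all norms on R^m are equivalent, so
   [closed] needs no counterpart. *)
Definition dot_norm (R : realType) (m : nat) (dot : {dot 'rV[R]_m for idfun})
  (x : 'rV[R]_m) : R := Num.sqrt (dot x x).

Definition dot_lipschitz_on (R : realType) (m : nat)
  (dot : {dot 'rV[R]_m for idfun}) (L : R) (D : set 'rV[R]_m)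
  (F : 'rV[R]_m -> 'rV[R]_m) : Prop :=
  forall x y, D x -> D y -> dot_norm dot (F x - F y) <= L * dot_norm dot (x - y).

(* Operators on D are total functions, of which only the values on D matter. *)
Definition nonexpansive_on (R : realType) (m : nat)
  (dot : {dot 'rV[R]_m for idfun}) (D : set 'rV[R]_m)
  (S : 'rV[R]_m -> 'rV[R]_m) : Prop :=
  forall x y, D x -> D y -> dot_norm dot (S x - S y) <= dot_norm dot (x - y).

Definition relaxation (R : realType) (m : nat) (a : R)
  (S : 'rV[R]_m -> 'rV[R]_m) (x : 'rV[R]_m) : 'rV[R]_m :=
  (1 - a) *: x + a *: S x.

(* Sequences indexed by {1, 2, ...} are functions on [nat] whose value at 0 is
   irrelevant; this is their set of values. *)
Definition values (R : realType) (u : nat -> R) : set R :=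
  u @` [set t | (0 < t)%N].

(* Main.v *)
Require Import Defs.
From mathcomp Require Import all_boot all_order all_algebra.
From mathcomp Require Import all_classical all_reals all_analysis.
From mathcomp Require Import ring lra.
Import Order.TTheory GRing.Theory Num.Theory.
Import numFieldNormedType.Exports.
Local Open Scope classical_set_scope.
Local Open Scope ring_scope.

(** Why the bounds hold.  Write [N] for [dot_norm dot], and [V t] for the
squared distance [N (x t - xstar t) ^+ 2].  The fixed points of [F t] are those
of [T t], as [alpha t != 0], so the parallelogram-type identity
[dot_norm_relaxation] turns nonexpansiveness of [T t] into a decrease of the
squared distance to [xstar t] by [alpha t * (1 - alpha t)] times the squared
residual [N (x t - T t (x t)) ^+ 2].

Two perturbations spoil this decrease.  Let [M] and [sigma] stand for the
suprema of the sequences.  The iteration applies [That t] instead of [T t],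
which displaces the new point by at most [e t], and the target moves from
[xstar t] to [xstar t.+1].  As [xstar t] and the relaxations of both [T t] and
[That t] stay in the ball of radius [M], the distances involved are at most
[2 * M]; the squared distance thus grows by at most [4 * M * e t] and
[sigma * (4 * M + sigma)] respectively.  This is [inexact_step]:

   [alpha t * (1 - alpha t) * N (x t - T t (x t)) ^+ 2
      <= V t - V t.+1 + 4 * M * e t + sigma * (4 * M + sigma)].

Averaged over [t <= n], the difference of [V] telescopes to [O(1 / n)] and the
error term is [o(1)] by the assumption on the sums of [e]; only the last
summand survives in the limit superior ([limsup_mean_le]).  The two inequalities
of the theorem differ by how the left-hand side is bounded below: the residual of
[F t] is [alpha t] times that of [T t], so the left-hand side is also
[(1 - alpha t) / alpha t] times the squared residual of [F t]. *)

(** * The norm of an inner product *)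

Section DotNorm.
Variables (R : realType) (m : nat) (dot : {dot 'rV[R]_m for idfun}).
Implicit Types (u v w : 'rV[R]_m) (a : R).
Local Notation N := (dot_norm dot).

Lemma dotC u v : dot u v = dot v u.
Proof. by rewrite hermC expr0 mul1r. Qed.

Lemma dot_self_ge0 u : 0 <= dot u u.
Proof.
have [->|u0] := eqVneq u 0; first by rewrite linear0l.
exact/ltW/neq0_dnorm_gt0.
Qed.

Lemma dot_norm_ge0 u : 0 <= N u.
Proof. exact: sqrtr_ge0. Qed.

Lemma dot_norm_sqr u : N u ^+ 2 = dot u u.
Proof. by rewrite sqr_sqrtr ?dot_self_ge0. Qed.

Lemma dot_norm_eq0 u : N u = 0 -> u = 0.
Proof.
move=> Nu0; apply/eqP; apply: contraT => /(@neq0_dnorm_gt0 _ _ _ dot).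
by rewrite -dot_norm_sqr Nu0 expr0n /= ltxx.
Qed.

Lemma dotDl u v w : dot (u + v) w = dot u w + dot v w.
Proof. exact: linearDl. Qed.

Lemma dotDr u v w : dot u (v + w) = dot u v + dot u w.
Proof. exact: linearDr. Qed.

Lemma dotZl a u v : dot (a *: u) v = a * dot u v.
Proof. exact: linearZl_LR. Qed.

Lemma dotZr a u v : dot u (a *: v) = a * dot u v.
Proof. by rewrite dotC dotZl dotC. Qed.

Lemma dot_norm_sqrD a b u v : N (a *: u + b *: v) ^+ 2 =
  a ^+ 2 * N u ^+ 2 + b ^+ 2 * N v ^+ 2 + 2 * a * b * dot u v.
Proof.
rewrite !dot_norm_sqr dotDl !dotDr !dotZl !dotZr.
by rewrite (dotC v u); ring.
Qed.

Lemma dot_normZ a u : N (a *: u) = `|a| * N u.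
Proof.
rewrite /dot_norm dotZl dotZr mulrA -expr2.
by rewrite sqrtrM ?sqr_ge0// sqrtr_sqr.
Qed.

Lemma dot_normN u : N (- u) = N u.
Proof. by rewrite -scaleN1r dot_normZ normrN1 mul1r. Qed.

Lemma dot_norm_distC u v : N (u - v) = N (v - u).
Proof. by rewrite -dot_normN opprB. Qed.

(** The Cauchy-Schwarz inequality: the squared norm of [N v *: u - N u *: v] is
nonnegative, and a nonzero [N u * N v] can be cancelled from its expansion. *)
Lemma dot_le_norms u v : dot u v <= N u * N v.
Proof.
have [Nu0|Nu_neq0] := eqVneq (N u) 0.
  by rewrite (dot_norm_eq0 u Nu0) linear0l mulr_ge0 ?dot_norm_ge0.
have [Nv0|Nv_neq0] := eqVneq (N v) 0.
  by rewrite (dot_norm_eq0 v Nv0) linear0r mulr_ge0 ?dot_norm_ge0.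
have uv_gt0 : 0 < N u * N v by rewrite mulr_gt0 // lt0r dot_norm_ge0 ?Nu_neq0 ?Nv_neq0.
rewrite -(ler_pM2l uv_gt0).
have := sqr_ge0 (N (N v *: u + (- N u) *: v)).
rewrite dot_norm_sqrD; lra.
Qed.

Lemma dot_norm_triangle u v : N (u + v) <= N u + N v.
Proof.
rewrite -(@ler_pXn2r _ 2)// ?nnegrE ?addr_ge0 ?dot_norm_ge0//.
have := dot_norm_sqrD 1 1 u v; rewrite !scale1r => ->.
have := dot_le_norms u v; lra.
Qed.

Lemma dot_norm_triangle_dist u v w : N (u - w) <= N (u - v) + N (v - w).
Proof. by apply: le_trans (dot_norm_triangle _ _); rewrite addrA subrK. Qed.

(** The defect of convexity of the squared norm; its last term is what makes
averaging a nonexpansive operator strictly decrease the distance to its fixed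
points. *)
Lemma dot_norm_relaxation a u v : N ((1 - a) *: u + a *: v) ^+ 2 =
  (1 - a) * N u ^+ 2 + a * N v ^+ 2 - a * (1 - a) * N (u - v) ^+ 2.
Proof.
have := dot_norm_sqrD 1 (-1) u v; rewrite scale1r scaleN1r => ->.
by rewrite dot_norm_sqrD; ring.
Qed.

(** * One step of the inexact averaged iteration *)

Lemma relaxation_fixed a (S : 'rV[R]_m -> 'rV[R]_m) p :
  a != 0 -> p = relaxation a S p -> S p = p.
Proof.
move=> a0 /eqP; rewrite /relaxation scalerBl scale1r addrAC -addrA -scalerBr.
rewrite addrC -subr_eq subrr eq_sym scaler_eq0 (negbTE a0) /= subr_eq0.
by move=> /eqP.
Qed.

Lemma sub_relaxation a (S : 'rV[R]_m -> 'rV[R]_m) y :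
  y - relaxation a S y = a *: (y - S y).
Proof.
by rewrite /relaxation scalerBl scale1r scalerBr opprD opprB addrA addrCA subrr addr0.
Qed.

Lemma averaged_contracts a (S : 'rV[R]_m -> 'rV[R]_m) p y :
  0 <= a -> S p = p -> N (S y - S p) <= N (y - p) ->
  N (relaxation a S y - p) ^+ 2 <=
    N (y - p) ^+ 2 - a * (1 - a) * N (y - S y) ^+ 2.
Proof.
move=> a0 Sp; rewrite Sp => Sle.
have -> : relaxation a S y - p = (1 - a) *: (y - p) + a *: (S y - p).
  by rewrite /relaxation !scalerBr addrACA -opprD -scalerDl subrK scale1r.
rewrite dot_norm_relaxation.
have -> : y - p - (S y - p) = y - S y by rewrite opprB addrA subrK.
have : N (S y - p) ^+ 2 <= N (y - p) ^+ 2 by rewrite lerXn2r ?nnegrE ?dot_norm_ge0.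
move=> /(ler_wpM2l a0); lra.
Qed.

Lemma relaxation_stable (D : set 'rV[R]_m) a (S : 'rV[R]_m -> 'rV[R]_m) y :
  convex_set D -> 0 <= a <= 1 -> set_fun D D S -> D y -> D (relaxation a S y).
Proof.
move=> D_convex /andP[a0 a1] S_D Dy.
have := D_convex (S y) y (Itv01 a0 a1); rewrite !inE => /(_ (S_D _ Dy) Dy).
by rewrite /relaxation addrC.
Qed.

(** Relative to the exact step of [averaged_contracts], the applied operator
[S'] displaces the new point by at most [e], and the target moves from [p] to
[q], by at most [s].  The ball of radius [M] has diameter [2 * M], which turns
each displacement into a bound on the growth of the squared distance. *)
Lemma inexact_step a e s M (S S' : 'rV[R]_m -> 'rV[R]_m) p q y :
  0 < a <= 1 -> p = relaxation a S p -> N (S y - S p) <= N (y - p) ->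
  N (S y - S' y) <= e -> N (q - p) <= s ->
  N p <= M -> N (relaxation a S y) <= M -> N (relaxation a S' y) <= M ->
  a * (1 - a) * N (y - S y) ^+ 2 <=
    N (y - p) ^+ 2 - N (relaxation a S' y - q) ^+ 2 + 4 * M * e + s * (4 * M + s).
Proof.
move=> /andP[a0 a1] pfix Sle ele sle pM FM F'M.
have Sp : S p = p by apply: relaxation_fixed (pfix); rewrite gt_eqF.
have := averaged_contracts a S p y (ltW a0) Sp Sle.
set f := N (relaxation a S y - p) => fle.
set h := N (relaxation a S' y - p).
have dist2M z : N z <= M -> N (z - p) <= 2 * M.
  by move=> zM; apply: le_trans (dot_norm_triangle _ _) _; rewrite dot_normN; lra.
have f2M : f <= 2 * M := dist2M _ FM.
have h2M : h <= 2 * M := dist2M _ F'M.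
have e0 : 0 <= e := le_trans (dot_norm_ge0 _) ele.
have s0 : 0 <= s := le_trans (dot_norm_ge0 _) sle.
have f0 : 0 <= f := dot_norm_ge0 _.
have h0 : 0 <= h := dot_norm_ge0 _.
have hf : h <= f + e.
  apply: le_trans (dot_norm_triangle_dist _ (relaxation a S y) _) _.
  rewrite addrC lerD2l /relaxation opprD addrACA subrr add0r -scalerBr.
  rewrite dot_normZ gtr0_norm// dot_norm_distC.
  by apply: le_trans ele; rewrite ler_piMl ?dot_norm_ge0.
have hfsqr : h ^+ 2 <= f ^+ 2 + 4 * M * e.
  have := ler_wpM2l h0 hf; have := ler_wpM2r f0 hf.
  have := ler_wpM2r e0 h2M; have := ler_wpM2r e0 f2M; lra.
have qsqr : N (relaxation a S' y - q) ^+ 2 <= h ^+ 2 + s * (4 * M + s).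
  have qh : N (relaxation a S' y - q) <= h + s.
    apply: le_trans (dot_norm_triangle_dist _ p _) _.
    by rewrite lerD2l dot_norm_distC.
  have : N (relaxation a S' y - q) ^+ 2 <= (h + s) ^+ 2.
    by rewrite lerXn2r ?nnegrE ?addr_ge0 ?dot_norm_ge0.
  have := ler_wpM2r s0 h2M; lra.
lra.
Qed.

End DotNorm.

(** * Averaging the step inequality *)

Section Averages.
Variable R : realType.
Implicit Types (u d e V : nat -> R) (c K B l : R).

Lemma limn_esup_le u l :
  (forall eps, 0 < eps -> \forall n \near \oo, u n <= l + eps) ->
  (limn_esup (fun n => (u n)%:E) <= l%:E)%E.
Proof.
move=> ul; apply/lee_addgt0Pr => eps eps0.
have ule := ul _ eps0.
apply: (@le_trans _ _ (ereal_sup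
    ((fun n => (u n)%:E) @` [set n | u n <= l + eps]))).
  by apply: ereal_inf_lbound; exists [set n | u n <= l + eps].
by apply: ge_ereal_sup => _ [n /= un <-]; rewrite -EFinD lee_fin.
Qed.

(** A telescoping difference and a sublinear error do not contribute to the
limiting mean, so that only the constant [K] remains. *)
Lemma limsup_mean_le d e V c B K :
  0 < c -> 0 <= B -> (forall t, 0 <= V t) ->
  (forall t, (0 < t)%N -> c * d t <= V t - V t.+1 + B * e t + K) ->
  (fun n : nat => \sum_(1 <= t < n.+1) e t : R^o)
    =o_\oo (fun n : nat => n%:R : R^o) ->
  (limn_esup (fun n : nat => (n%:R^-1 * \sum_(1 <= t < n.+1) d t)%:E)
     <= (c^-1 * K)%:E)%E.
Proof.
move=> c0 B0 V0 step /eqoP e_sum; apply: limn_esup_le => eps eps0.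
have ceps0 : 0 < c * eps by rewrite mulr_gt0.
(* Half of the slack [c * eps] goes to each of the two vanishing terms;
   [B + 1] avoids a division by zero. *)
have eps'0 : 0 < c * eps / (2 * (B + 1)) by rewrite divr_gt0// mulr_gt0//; lra.
set k := c * eps / (2 * (B + 1)) in eps'0.
have kE : k * (2 * (B + 1)) = c * eps by rewrite divfK// gt_eqF// mulr_gt0//; lra.
have k0 : 0 <= k := ltW eps'0.
have := e_sum _ eps'0; have := nbhs_infty_ger (2 * V 1%N / (c * eps)).
apply: filterS3 (nbhs_infty_ge 1) => n n_ge1 nV.
rewrite [X in _ <= _ * X]ger0_norm// => /(le_trans (ler_norm _)) en.
have n0 : 0 < n%:R :> R by rewrite ltr0n.
move: nV; rewrite ler_pdivrMr// => nV.
have sum_step : c * \sum_(1 <= t < n.+1) d t <=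
    V 1%N - V n.+1 + B * \sum_(1 <= t < n.+1) e t + n%:R * K.
  have telV : \sum_(1 <= t < n.+1) (V t - V t.+1) = V 1%N - V n.+1.
    rewrite -[RHS]opprB -telescope_sumr// -sumrN.
    by apply: eq_bigr => t _; rewrite opprB.
  have sumK : \sum_(1 <= t < n.+1) K = n%:R * K.
    by rewrite sumr_const_nat subn1 mulr_natl.
  rewrite -telV -sumK !mulr_sumr -!big_split /= big_nat [leRHS]big_nat.
  by apply: ler_sum => t /andP[t0 _]; exact: step.
rewrite ler_pdivrMl// -(ler_pM2l c0) mulrCA mulrDr mulVKf ?gt_eqF//.
apply: le_trans sum_step _.
have := ler_wpM2l B0 en; have := V0 n.+1; have := mulr_ge0 k0 (ltW n0).
rewrite -kE in nV *; lra.
Qed.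

Lemma le_sup_values u t : has_ubound (values u) -> (0 < t)%N ->
  u t <= sup (values u).
Proof. by move=> ub t0; apply: ub_le_sup => //; exists t. Qed.

Lemma inf_values_le u t : (forall t, (0 < t)%N -> 0 <= u t) -> (0 < t)%N ->
  inf (values u) <= u t.
Proof.
move=> u0 t0; apply: ge_inf; last by exists t.
by exists 0 => _ [i /= i0 <-]; exact: u0.
Qed.

End Averages.

Theorem corollary1 (R : realType) (m : nat) (dot : {dot 'rV[R]_m for idfun})
  (D : set 'rV[R]_m) (D_neq0 : D !=set0) (D_closed : closed D)
  (D_convex : convex_set D)
  (alpha : nat -> R) (T That : nat -> 'rV[R]_m -> 'rV[R]_m)
  (xstar : nat -> 'rV[R]_m) (sigma e L M : nat -> R) (x : nat -> 'rV[R]_m)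
  (alpha_itv : forall t, (0 < t)%N -> 0 < alpha t < 1)
  (T_D : forall t, (0 < t)%N -> set_fun D D (T t))
  (T_nonexpansive : forall t, (0 < t)%N -> nonexpansive_on dot D (T t))
  (xstar_D : forall t, (0 < t)%N -> D (xstar t))
  (xstar_fix : forall t, (0 < t)%N ->
    xstar t = relaxation (alpha t) (T t) (xstar t))
  (sigma_ge0 : forall t, (0 < t)%N -> 0 <= sigma t)
  (xstar_drift : forall t, (0 < t)%N ->
    dot_norm dot (xstar t.+1 - xstar t) <= sigma t)
  (That_D : forall t, (0 < t)%N -> set_fun D D (That t))
  (That_error : forall t, (0 < t)%N -> forall y, D y ->
    dot_norm dot (T t y - That t y) <= e t)
  (L_itv : forall t, (0 < t)%N -> 0 <= L t <= 1)
  (F_lipschitz : forall t, (0 < t)%N ->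
    dot_lipschitz_on dot (L t) D (relaxation (alpha t) (T t)))
  (F_bounded : forall t, (0 < t)%N -> forall y, D y ->
    dot_norm dot (relaxation (alpha t) (T t) y) <= M t /\
    dot_norm dot (relaxation (alpha t) (That t) y) <= M t)
  (M_finite : has_ubound (values M))
  (sigma_finite : has_ubound (values sigma))
  (e_finite : has_ubound (values e))
  (e_sum : (fun n : nat => \sum_(1 <= t < n.+1) e t : R^o)
             =o_\oo (fun n : nat => n%:R : R^o))
  (x1_D : D (x 1%N))
  (x_rec : forall t, (0 < t)%N -> x t.+1 = relaxation (alpha t) (That t) (x t)) :
  let Msup := sup (values M) in
  let sigmasup := sup (values sigma) in
  let alpha_check := inf (values (fun t => alpha t * (1 - alpha t))) in
  let alpha_bar := inf (values (fun t => (1 - alpha t) / alpha t)) in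
  (0 < alpha_check ->
    (limn_esup (fun n : nat =>
       (n%:R^-1 * \sum_(1 <= t < n.+1) dot_norm dot (x t - T t (x t)) ^+ 2)%:E)
     <= (alpha_check^-1 * (sigmasup * (4 * Msup + sigmasup)))%:E)%E) /\
  (0 < alpha_bar ->
    (limn_esup (fun n : nat =>
       (n%:R^-1 * \sum_(1 <= t < n.+1)
          dot_norm dot (x t - relaxation (alpha t) (T t) (x t)) ^+ 2)%:E)
     <= (alpha_bar^-1 * (sigmasup * (4 * Msup + sigmasup)))%:E)%E).
Proof.
move=> Msup sigmasup alpha_check alpha_bar.
have x_D t : (0 < t)%N -> D (x t).
  elim: t => // -[//|t] IHt _; rewrite x_rec//.
  apply: relaxation_stable (D_convex) _ (That_D t.+1 isT) (IHt isT).
  by have /andP[/ltW-> /ltW] := alpha_itv t.+1 isT.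
have M_le t : (0 < t)%N -> M t <= Msup by exact: le_sup_values.
have Msup_ge0 : 0 <= Msup.
  have [Fx1 _] := F_bounded 1%N isT _ x1_D.
  exact: le_trans (dot_norm_ge0 _ _ _ _) (le_trans Fx1 (M_le 1%N isT)).
set V := fun t => dot_norm dot (x t - xstar t) ^+ 2.
have V_ge0 t : 0 <= V t by exact: sqr_ge0.
set K := sigmasup * (4 * Msup + sigmasup).
have step t : (0 < t)%N ->
    alpha t * (1 - alpha t) * dot_norm dot (x t - T t (x t)) ^+ 2 <=
    V t - V t.+1 + 4 * Msup * e t + K.
  move=> t0; have /andP[a0 a1] := alpha_itv t t0.
  have [FxM FhatxM] := F_bounded t t0 _ (x_D t t0).
  have [FpM _] := F_bounded t t0 _ (xstar_D t t0).
  rewrite -xstar_fix// in FpM.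
  rewrite /V x_rec//; apply: inexact_step.
  - by rewrite a0 ltW.
  - exact: xstar_fix.
  - by apply: T_nonexpansive => //; [exact: x_D|exact: xstar_D].
  - by apply: That_error => //; exact: x_D.
  - by apply: le_trans (xstar_drift t t0) _; exact: le_sup_values.
  - exact: le_trans FpM (M_le t t0).
  - exact: le_trans FxM (M_le t t0).
  - exact: le_trans FhatxM (M_le t t0).
split=> [alpha_check_gt0|alpha_bar_gt0].
  apply: (limsup_mean_le _ _ e V _ (4 * Msup)) => // [|t t0].
    by rewrite mulr_ge0.
  apply: le_trans (step t t0); rewrite ler_wpM2r ?sqr_ge0//.
  apply: (inf_values_le _ (fun t => alpha t * (1 - alpha t))) => // i i0.
  have /andP[a0 a1] := alpha_itv i i0.
  by rewrite mulr_ge0 ?subr_ge0 ?ltW.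
apply: (limsup_mean_le _ _ e V _ (4 * Msup)) => // [|t t0].
  by rewrite mulr_ge0.
rewrite sub_relaxation dot_normZ exprMn real_normK ?num_real//.
have /andP[a0 a1] := alpha_itv t t0.
apply: le_trans (step t t0); rewrite mulrA ler_wpM2r ?sqr_ge0//.
have -> : alpha t * (1 - alpha t) = (1 - alpha t) / alpha t * alpha t ^+ 2.
  by field; rewrite gt_eqF.
rewrite ler_wpM2r ?sqr_ge0//.
apply: (inf_values_le _ (fun t => (1 - alpha t) / alpha t)) => // i i0.
have /andP[ai0 ai1] := alpha_itv i i0.
by rewrite divr_ge0 ?subr_ge0 ?ltW.
Qed.
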